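(* Let $1\le q<\infty$, $\omega\ge0$, and let $A$ be an operator on $L^q(\Sigma,\mu)$ such that $A+\omega I$ is $m$-accretive in $L^q(\Sigma,\mu)$. Suppose that there are $1\le r\le\infty$, $\varrho\ge0$, $\sigma>0$ and $C>0$ such that $$\|u-\hat u\|_r^\sigma\le C\Big([u-\hat u,v-\hat v]_q+\omega\|u-\hat u\|_q^q\Big)\|u-\hat u\|_q^\varrho\qquad\text{for every }(u,v),(\hat u,\hat v)\in A,$$ and that the semigroup $\{T_t\}_{t\ge0}$ generated by $-A$ on $\overline{D(A)}^{L^q}$ satisfies $$\|T_tu-T_t\hat u\|_r\le e^{\omega t}\|u-\hat u\|_r\qquad\text{for every }u,\hat u\in\overline{D(A)}^{L^q}\cap L^r(\Sigma,\mu),\ t>0.$$ Then $$\|T_tu-T_t\hat u\|_r\le\Big(\tfrac Cq\Big)^{1/\sigma}t^{-\alpha}e^{\omega\beta t}\|u-\hat u\|_q^\gamma$$ for every $t>0$ and $u,\hat u\in\overline{D(A)}^{L^q}$, with $\alpha=\frac1\sigma$, $\beta=\gamma+1$ and $\gamma=\frac{q+\varrho}\sigma$.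
   Context: $(\Sigma,\mu)$ is a $\sigma$-finite measure space; functions are real-valued. An operator $A$ on $L^{q}(\Sigma,\mu)$ is a subset $A\subseteq L^q\times L^q$ (possibly multi-valued), with domain $D(A)$ and range $Rg(A)$; $\overline{D(A)}^{L^q}$ is the closure of the domain in $L^q$. The $q$-bracket is $[u,v]_q=\int_\Sigma |u|^{q-2}u\,v\,d\mu$ if $1<q<\infty$, and $[u,v]_1=\int_{\{u\ne0\}}\mathrm{sign}(u)\,v\,d\mu+\int_{\{u=0\}}|v|\,d\mu$. An operator $B$ is accretive in $L^q$ if for every $\lambda>0$ the resolvent $(I+\lambda B)^{-1}$ is single-valued and nonexpansive on $Rg(I+\lambda B)$ in the $L^q$-norm; it is $m$-accretive if in addition $Rg(I+\lambda B)=L^q$ for some (equivalently all) $\lambda>0$. The semigroup generated by $-A$ is $T_tu=\lim_{n\to\infty}(I+\frac tnA)^{-n}u$ in $L^q$ for $u\in\overline{D(A)}^{L^q}$.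
   Formalization: The formal theorem additionally assumes that D(A) contains at least one element of L^r; without this the growth hypothesis on T_t can be void and the claimed estimate can fail. *)

(* Defs.v *)
From HB Require Import structures.
From mathcomp Require Import all_boot all_order all_algebra.
From mathcomp Require Import all_classical all_reals all_analysis.
Set Implicit Arguments.
Unset Strict Implicit.
Unset Printing Implicit Defensive.
Import Order.TTheory GRing.Theory Num.Theory.
Import numFieldNormedType.Exports.
Local Open Scope classical_set_scope.
Local Open Scope ring_scope.

(* The elements of [LspaceType mu q1] are the classes modulo a.e. equality of
   the functions with finite L^q-norm. The library gives this type no vector
   space structure, so linear combinations are written on representatives and
   compared with [= %[ae mu]]; differences are only used inside norms and
   brackets, which do not depend on the representatives. *)

Definition Ldist d (S : measurableType d) (R : realType)
    (mu : {measure set S -> \bar R}) (p : \bar R) (f g : S -> R) : \bar R :=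
  'N[mu]_p[EFin \o (f \- g)%R]%E.

Section Bracket.
Context d (S : measurableType d) (R : realType).
Variables (mu : {measure set S -> \bar R}) (q : R).

(* [powR] satisfies [0 `^ a = 0] for [a != 0] and [0 `^ 0 = 1], so the first
   integrand vanishes where [u] does, also when [q < 2]. *)
Definition bracket (u v : S -> R) : \bar R :=
  if q == 1 then
    (\int[mu]_(x in [set x | u x != 0%R]) (Num.sg (u x) * v x)%:E +
     \int[mu]_(x in [set x | u x == 0%R]) `|v x|%:E)%E
  else (\int[mu]_x (`|u x| `^ (q - 2) * u x * v x)%:E)%E.

End Bracket.

Section Operators.
Context d (S : measurableType d) (R : realType).
Variables (mu : {measure set S -> \bar R}) (q : \bar R) (q1 : (1 <= q)%E).
Local Notation Lq := (LspaceType mu q1).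

Definition operator := set (Lq * Lq).

Definition dom (B : operator) : set Lq := fst @` B.

Definition rg (B : operator) : set Lq := snd @` B.

Definition inv_op (B : operator) : operator := [set z | B (z.2, z.1)].

(* the operator [a I + b B] *)
Definition lin_op (a b : R) (B : operator) : operator :=
  [set z : Lq * Lq | exists2 v : Lq, B (z.1, v) &
     (z.2 : S -> R) = (fun x : S => a * z.1 x + b * v x) %[ae mu]].

Definition resolvent (l : R) (B : operator) : operator :=
  inv_op (lin_op 1 l B).

Definition single_valued (B : operator) : Prop :=
  forall w u u', B (w, u) -> B (w, u') -> u = u'.

Definition nonexpansive (B : operator) : Prop :=
  forall w u w' u', B (w, u) -> B (w', u') ->
    (Ldist mu q u u' <= Ldist mu q w w')%E.

Definition accretive (B : operator) : Prop :=
  forall l : R, 0 < l ->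
    single_valued (resolvent l B) /\ nonexpansive (resolvent l B).

Definition m_accretive (B : operator) : Prop :=
  accretive B /\ exists2 l : R, 0 < l & rg (lin_op 1 l B) = [set: Lq].

Definition Lq_closure (D : set Lq) : set Lq :=
  [set u | forall e : R, 0 < e -> exists2 v : Lq, D v &
     (Ldist mu q u v < e%:E)%E].

Fixpoint pow_op (B : operator) (n : nat) : operator :=
  if n is n'.+1 then
    [set z : Lq * Lq | exists2 w : Lq, B (z.1, w) & pow_op B n' (w, z.2)]
  else [set z : Lq * Lq | z.1 = z.2].

(* [T] is the semigroup generated by [- A]: T_t u is the L^q-limit of
   (I + (t/n) A)^{-n} u. The iterates only need to be defined for large [n]:
   if A + omega I is m-accretive, then (I + l A)^{-1} is single-valued and
   everywhere defined when l * omega < 1, but in general not for larger l.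
   The case t = 0 is separate because [resolvent 0 A] is the identity of D(A)
   only, not of its closure. *)
Definition generated_semigroup (A : operator) (T : R -> Lq -> Lq) : Prop :=
  forall u : Lq, Lq_closure (dom A) u ->
    T 0 u = u /\ forall t : R, 0 < t -> exists x : nat -> Lq,
      (\forall n \near \oo, pow_op (resolvent (t / n%:R) A) n (u, x n)) /\
      (Ldist mu q (x n) (T t u) @[n --> \oo] --> 0)%E.

End Operators.

(* Main.v *)
Require Import Defs.
From HB Require Import structures.
From mathcomp Require Import all_boot all_order all_algebra.
From mathcomp Require Import all_classical all_reals all_analysis.
From mathcomp Require Import measurable_realfun ess_sup_inf ring lra zify.
Set Implicit Arguments.
Unset Strict Implicit.
Unset Printing Implicit Defensive.
Import Order.TTheory GRing.Theory Num.Theory.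
Import numFieldNormedType.Exports.
Local Open Scope classical_set_scope.
Local Open Scope ring_scope.

(* Work with implicit Euler chains c_k = (I + h A)^{-k} u and c'_k, of step
   h = t/n. Convexity of |.|^q bounds the bracket of c_k - c'_k with the
   difference quotient, so the hypothesis on A becomes
     h |c_k - c'_k|_r^sigma
       <= C/q (a_{k-1}^q - (1 - q omega h) a_k^q) a_k^rho,  a_k = |c_k - c'_k|_q.
   Multiplied by (1 - q omega h)^{k-1} the right-hand side telescopes, and for
   some k the quantity |c_k - c'_k|_r is at most the claimed bound up to
   e^{omega t}. The growth hypothesis on T, applied to c_k and c'_k over the
   remaining time, gives this bound for points of L^q that converge to T_t u and
   T_t u', and the L^r-norm is lower semicontinuous for the convergence in L^q.
   All the c_k belong to D(A), hence to L^r, and no differentiability of the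
   semigroup is used; this covers q = 1. *)

(** * Real powers *)

Section PowR.
Context (R : realType).
Implicit Types (q w v h x : R).

(** The left-hand side is the derivative of |.|^q at w in the direction v, so this is the tangent
    inequality of a convex function. It is obtained without differentiation from Young's inequality
    for |w|^(q-1) and |w + v|, with exponents q/(q-1) and q. *)
Lemma powR_subgradient q w v : 1 < q ->
  q * (`|w| `^ (q - 2) * w * v) <= `|w + v| `^ q - `|w| `^ q.
Proof.
move=> q1.
have q0 : 0 < q by lra.
have [->|w0] := eqVneq w 0.
  by rewrite mulr0 mul0r mulr0 normr0 powR0 ?gt_eqF// subr0 powR_ge0.
have nw0 : `|w| != 0 by rewrite normr_eq0.
have nw : 0 < `|w| by rewrite normr_gt0.
set b := `|w + v|.
have E2 : `|w| `^ (q - 1) = `|w| `^ (q - 2) * `|w|.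
  rewrite -[X in _ = _ * X](powRr1 (ltW nw)) -powRD; last by rewrite nw0 implybT.
  by congr (_ `^ _); lra.
have E1 : `|w| `^ q = `|w| `^ (q - 1) * `|w|.
  by rewrite mulrC mulr_powRB1.
(* Here w v = w (w + v) - w^2 <= |w| |w + v| - |w|^2, multiplied by |w|^(q-2). *)
have le1 : `|w| `^ (q - 2) * w * v <= `|w| `^ (q - 1) * b - `|w| `^ q.
  rewrite E1 E2 -!mulrA -mulrBr ler_wpM2l ?powR_ge0//.
  rewrite -[X in _ - X]expr2 real_normK ?num_real// /b -normrM lerBrDr.
  by rewrite expr2 -mulrDr addrC ler_norm.
have yng : `|w| `^ (q - 1) * b <=
    (`|w| `^ (q - 1)) `^ (q / (q - 1)) / (q / (q - 1)) + b `^ q / q.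
  apply: conjugate_powR; rewrite ?powR_ge0 ?normr_ge0//.
  - by rewrite divr_gt0// subr_gt0.
  - by field; apply/andP; split; lra.
rewrite -powRrM (_ : (q - 1) * (q / (q - 1)) = q) in yng; last by field; lra.
have : q * (`|w| `^ (q - 1) * b) <= (q - 1) * `|w| `^ q + b `^ q.
  apply: le_trans (ler_wpM2l (ltW q0) yng) _.
  rewrite le_eqVlt; apply/orP; left; apply/eqP; field.
  by apply/andP; split; lra.
by move: (ler_wpM2l (ltW q0) le1); lra.
Qed.

(** For q > 1 this is the tangent inequality at 1 with increment -x. With x = h omega it compares
    the weight 1 - q omega h with the q-th power of the factor 1 - h omega of the resolvents. *)
Lemma bernoulli_powR q x : 1 <= q -> x <= 1 -> 1 - q * x <= (1 - x) `^ q.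
Proof.
rewrite le_eqVlt => /predU1P[<-|q1] x1.
  by rewrite mul1r powRr1// subr_ge0.
have := powR_subgradient 1 (- x) q1.
rewrite normr1 !powR1 !mul1r ger0_norm ?subr_ge0//.
by rewrite mulrN lerBrDr addrC.
Qed.

(** With y = x/n the condition reads y (1 + e) <= e, which is what makes 1/(1 - y) <= 1 + y (1 + e)
    <= exp(y (1 + e)). Taking n-th powers and inverses gives the bound; the loss e in the exponent
    can be made arbitrarily small for large n. *)
Lemma expR_le_exprn x (e : R) (n : nat) : 0 <= x -> 0 < e -> x * (1 + e) <= e * n%:R ->
  expR (- (x * (1 + e))) <= (1 - x / n%:R) ^+ n.
Proof.
move=> x0 e0 xn.
have [->|n0] := eqVneq n 0.
  by rewrite expr0 -[leRHS]expR0 ler_expR oppr_le0 mulr_ge0// addr_ge0// ltW.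
have n0' : 0 < n%:R :> R by rewrite ltr0n lt0n.
rewrite -[X in - X](@divfK _ n%:R) ?gt_eqF// mulrC -mulrN expRM_natl.
apply: lerXn2r; rewrite ?nnegrE ?expR_ge0//.
  rewrite subr_ge0 ler_pdivrMr// mul1r.
  by have := ler0n R n; nra.
set y := x / n%:R.
have yn : x * (1 + e) / n%:R = y * (1 + e) by rewrite /y; field; rewrite gt_eqF.
have y0 : 0 <= y by rewrite divr_ge0.
have ye : y * (1 + e) <= e by rewrite -yn ler_pdivrMr.
have y1 : 0 < 1 - y by nra.
rewrite yn expRN -[leRHS]invrK lef_pV2 ?posrE ?expR_gt0 ?invr_gt0//.
apply: le_trans (expR_ge1Dx _).
by rewrite -div1r ler_pdivrMr//; nra.
Qed.

End PowR.

(** * Integrals and L^p distances *)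

Section Bracket.
Context d (S : measurableType d) (R : realType).
Variable mu : {measure set S -> \bar R}.
Local Open Scope ereal_scope.

(* unlike [le_integral], the smaller function may have integral [-oo] *)
Lemma le_integral_integrable (D : set S) (f g : S -> \bar R) :
  measurable D -> measurable_fun D f -> mu.-integrable D g ->
  (forall x, D x -> f x <= g x) ->
  \int[mu]_(x in D) f x <= \int[mu]_(x in D) g x.
Proof.
move=> mD mf /integrableP[mg _] fg; rewrite integralE [leRHS]integralE.
apply: leeB; apply: ge0_le_integral => //.
- exact: measurable_funepos.
- exact: measurable_funepos.
- by move=> x Dx; rewrite !funeposE le_max2// fg.
- exact: measurable_funeneg.
- exact: measurable_funeneg.
- by move=> x Dx; rewrite !funenegE le_max2// leeN2 fg.
Qed.

Lemma integrable_powR_norm (q : R) (f : S -> R) : (1 <= q)%R ->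
  measurable_fun [set: S] f -> finite_norm mu q%:E f ->
  mu.-integrable [set: S] (fun x => (`|f x| `^ q)%:E).
Proof.
move=> q1 mf ff; apply: (@Lfun_integrable _ _ _ mu f q) => //.
by rewrite inE; apply/andP; split; rewrite ?inE.
Qed.

Lemma integral_powR_norm (q : R) (f : S -> R) : (1 <= q)%R ->
  finite_norm mu q%:E f ->
  \int[mu]_x (`|f x| `^ q)%:E = (fine 'N[mu]_q%:E[EFin \o f] `^ q)%:E.
Proof.
move=> q1 ff; rewrite -poweR_EFin fineK; last first.
  by rewrite ge0_fin_numE ?Lnorm_ge0.
rewrite poweR_Lnorm; last by rewrite gt_eqF// (lt_le_trans ltr01).
by apply: eq_integral => x _ /=; rewrite -poweR_EFin.
Qed.

(** The tangent inequality with increment h g is divided by q h and integrated. For q = 1 it is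
    replaced by sign(f) h g <= |f + h g| - |f| where f is nonzero and by an equality where f
    vanishes, which is the splitting in the definition of the bracket. *)
Lemma bracket_le (q h : R) (f g : S -> R) : (1 <= q)%R -> (0 < h)%R ->
  measurable_fun [set: S] f -> measurable_fun [set: S] g ->
  finite_norm mu q%:E f -> finite_norm mu q%:E (fun x => f x + h * g x)%R ->
  bracket mu q f g <=
  ((q * h)^-1 * (fine 'N[mu]_q%:E[EFin \o (fun x => f x + h * g x)%R] `^ q -
    fine 'N[mu]_q%:E[EFin \o f] `^ q))%:E.
Proof.
move=> q1 h0 mf mg ff fg.
have q0 : (0 < q)%R by rewrite (lt_le_trans ltr01).
have mfg : measurable_fun setT (fun x => f x + h * g x)%R.
  by apply: measurable_funD => //; exact: measurable_funM.
have i1 := integrable_powR_norm q1 mf ff.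
have i2 := integrable_powR_norm q1 mfg fg.
set G := fun x => ((q * h)^-1)%:E * ((`|f x + h * g x| `^ q)%:E - (`|f x| `^ q)%:E).
have iG : mu.-integrable [set: S] G.
  by apply: integrableZl => //; exact: integrableB.
have IG : \int[mu]_x G x = ((q * h)^-1 *
    (fine 'N[mu]_q%:E[EFin \o (fun x => f x + h * g x)%R] `^ q -
    fine 'N[mu]_q%:E[EFin \o f] `^ q))%:E.
  rewrite integralZl//; last exact: integrableB.
  by rewrite integralB//= !integral_powR_norm.
rewrite -IG /bracket; case: ifPn => [/eqP q_eq1|q_neq1].
  have mD1 : measurable [set x | f x != 0%R].
    rewrite (_ : [set x | _] = f @^-1` (~` [set 0%R])).
      by rewrite -[X in measurable X]setTI; apply: mf => //; exact: measurableC.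
    by apply/seteqP; split => x /=; [move/eqP|move/eqP].
  have mD2 : measurable [set x | f x == 0%R].
    rewrite (_ : [set x | _] = f @^-1` [set 0%R]).
      by rewrite -[X in measurable X]setTI; apply: mf.
    by apply/seteqP; split => x /=; [move/eqP|move/eqP].
  have DU : [set: S] = [set x | f x != 0%R] `|` [set x | f x == 0%R].
    by apply/seteqP; split => x //= _; case: (f x == 0%R); [right|left].
  rewrite [leRHS](_ : _ = \int[mu]_(x in [set x | f x != 0%R]) G x +
    \int[mu]_(x in [set x | f x == 0%R]) G x); last first.
    rewrite -integral_setU//=.
    - by rewrite DU.
    - by case/integrableP : iG => + _; rewrite DU.
    - by apply/disj_setPS => x [/= /negbTE ->].
  apply: leeD; apply: le_integral_integrable => //.
  - apply/measurable_EFinP/measurable_funM => //.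
      apply: measurable_funS (measurableT_comp _ mf) => //.
      apply: nondecreasing_measurable => // x y xy.
      by case: (sgrP x) (sgrP y) => [?|?|?] [?|?|?]; lra.
    exact: measurable_funS mg.
  - exact: integrableS iG.
  - move=> x /= fx0; rewrite /G -EFinB -EFinM lee_fin q_eq1 mul1r !powRr1//.
    rewrite -(ler_pM2l h0) [leRHS]mulrA mulfV ?gt_eqF// mul1r mulrCA lerBrDl.
    rewrite [X in (X + _ <= _)%R]normrEsg -mulrDr (le_trans (ler_norm _))//.
    by rewrite normrM normr_sg fx0 mul1r.
  - apply/measurable_EFinP/measurableT_comp => //.
    exact: measurable_funS mg.
  - exact: integrableS iG.
  - move=> x /= /eqP fx0; rewrite /G -EFinB -EFinM lee_fin q_eq1 mul1r !powRr1//.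
    by rewrite fx0 normr0 add0r subr0 normrM (gtr0_norm h0) mulrA mulVf ?gt_eqF// mul1r.
apply: le_integral_integrable => //.
- apply/measurable_EFinP/measurable_funM => //.
  apply/measurable_funM => //.
  by apply: (measurableT_comp (measurable_powR _)); exact: measurableT_comp.
- move=> x _; rewrite /G -EFinB -EFinM lee_fin.
  have {}q1 : (1 < q)%R by rewrite lt_neqAle eq_sym q_neq1.
  rewrite -(ler_pM2l (mulr_gt0 q0 h0)) [leRHS]mulrA mulfV ?mulf_neq0 ?gt_eqF// mul1r.
  apply: le_trans (powR_subgradient _ _ q1).
  by rewrite le_eqVlt; apply/orP; left; apply/eqP; ring.
Qed.
End Bracket.

(** * Elements of L^p: representatives, linear combinations and distances *)

Section Lspace_distance.
Context d (S : measurableType d) (R : realType).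
Variable mu : {measure set S -> \bar R}.

Lemma ae_eq_Lnorm (p : \bar R) (f g : S -> R) : (1 <= p)%E ->
  measurable_fun [set: S] f -> measurable_fun [set: S] g -> f = g %[ae mu] ->
  ('N[mu]_p[EFin \o f] = 'N[mu]_p[EFin \o g])%E.
Proof.
move=> p1 mf mg fg; rewrite unlock /Lnorm; case: p p1 => [r r1|_|//].
  congr (_ `^ _)%E; apply: ge0_ae_eq_integral => //.
  - apply/measurable_EFinP/(measurableT_comp (measurable_powR _)).
    exact: measurableT_comp.
  - apply/measurable_EFinP/(measurableT_comp (measurable_powR _)).
    exact: measurableT_comp.
  - by move=> x _; rewrite lee_fin powR_ge0.
  - by move=> x _; rewrite lee_fin powR_ge0.
  - by apply: filterS fg => x /= /[apply] ->.
case: ifPn => // _; apply: eq_ess_sup.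
by apply: filterS fg => x /= /(_ I) ->.
Qed.

Variables (p : \bar R) (p1 : (1 <= p)%E).
Local Notation Lp := (LspaceType mu p1).
Implicit Types u v w : Lp.

Lemma measurable_Lspace u : measurable_fun [set: S] (u : S -> R).
Proof.
exact: (measurable_funPT (repr (u : {mfun_ mu, S >-> measurableTypeR R}))).
Qed.
Hint Resolve measurable_Lspace : core.

Lemma Lspace_Lfun u : (u : S -> R) \in Lfun mu p.
Proof.
rewrite inE; apply/andP; split; rewrite inE/=; first exact: measurable_Lspace.
exact: Lebesgue_finite.
Qed.
Hint Resolve Lspace_Lfun : core.

Lemma Lfun_Lspace (f : S -> R) : f \in Lfun mu p ->
  exists u, (u : S -> R) = f %[ae mu].
Proof.
move=> fL; have [mf ff] : measurable_fun [set: S] f /\ finite_norm mu p f.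
  by move: fL; rewrite inE => /andP[]; rewrite !inE.
pose g : {mfun S >-> measurableTypeR R} :=
    @mfun_Sub _ _ S (measurableTypeR R) f (mem_set mf).
pose F : {mfun_ mu, S >-> measurableTypeR R} := (\pi g)%qT.
have Fg : (F : S -> R) = f %[ae mu].
  have : (repr F == g %[mod {mfun_ mu, S >-> measurableTypeR R}])%qT.
    by rewrite reprK.
  by rewrite eqmodE => /asboolP.
have fF : finite_norm mu p F.
  rewrite /finite_norm (ae_eq_Lnorm p1 _ mf Fg)//.
  exact: (measurable_funPT (repr F)).
by exists (HB.pack_for Lp F (isFinLebesgue.Build d S R mu p p1 F fF)).
Qed.

Lemma Lspace_lin (a b : R) u v :
  exists w, (w : S -> R) = (fun x => a * u x + b * v x) %[ae mu].
Proof.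
apply: Lfun_Lspace.
rewrite (_ : (fun _ => _) = a *: (u : S -> R) + b *: (v : S -> R))//.
have -> : (u : S -> R) = Lfun_Sub p1 (Lspace_Lfun u) by [].
have -> : (v : S -> R) = Lfun_Sub p1 (Lspace_Lfun v) by [].
exact: (LfunP (a *: Lfun_Sub p1 (Lspace_Lfun u) + b *: Lfun_Sub p1 (Lspace_Lfun v))).
Qed.

Lemma LnormZ_Lfun (a : R) (f : S -> R) : f \in Lfun mu p ->
  ('N[mu]_p[EFin \o (fun x => (a * f x)%R)] = `|a|%:E * 'N[mu]_p[EFin \o f])%E.
Proof. by move=> fL; rewrite -(LnormZ (Lfun_Sub p1 fL)). Qed.

(** In the exponent of the space itself the distance is finite ([dstE]), so [fine] loses nothing and
    estimates take place in R. The distance in another exponent r may be infinite and stays in the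
    extended reals. *)
Definition dst u v : R := fine (Ldist mu p u v).

Lemma Lspace_sub_Lfun u v : ((u : S -> R) \- v)%R \in Lfun mu p.
Proof.
have -> : (u : S -> R) = Lfun_Sub p1 (Lspace_Lfun u) by [].
have -> : (v : S -> R) = Lfun_Sub p1 (Lspace_Lfun v) by [].
exact: (LfunP (Lfun_Sub p1 (Lspace_Lfun u) - Lfun_Sub p1 (Lspace_Lfun v))).
Qed.

Lemma dstE u v : (Ldist mu p u v = (dst u v)%:E)%E.
Proof.
rewrite /dst fineK// ge0_fin_numE ?Lnorm_ge0//.
by have := Lspace_sub_Lfun u v; rewrite inE => /andP[_]; rewrite inE.
Qed.

Lemma dst_ge0 u v : 0 <= dst u v.
Proof. by rewrite fine_ge0// Lnorm_ge0. Qed.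

Lemma LdistC r u v : Ldist mu r u v = Ldist mu r v u.
Proof.
rewrite /Ldist -(oppe_Lnorm mu (EFin \o (v \- u)%R)).
by apply: eq_Lnorm => x /=; rewrite opprB.
Qed.

Lemma dstC u v : dst u v = dst v u.
Proof. by rewrite /dst LdistC. Qed.

Lemma Ldist_triangle r u v w : (1 <= r)%E ->
  (Ldist mu r u w <= Ldist mu r u v + Ldist mu r v w)%E.
Proof.
move=> r1; apply: le_trans (eminkowski mu _ _ r1); last 2 first.
- exact: measurable_funB.
- exact: measurable_funB.
rewrite le_eqVlt; apply/orP; left; apply/eqP; apply: eq_Lnorm => x /=.
by rewrite addrA subrK.
Qed.

Lemma dst_triangle v u w : dst u w <= dst u v + dst v w.
Proof. by rewrite -lee_fin EFinD -!dstE Ldist_triangle. Qed.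

Lemma dstuu u : dst u u = 0.
Proof.
rewrite /dst /Ldist (eq_Lnorm _ _ (g := cst 0%E)) ?Lnorm0//.
- by rewrite gt_eqF// (lt_le_trans _ p1).
- by move=> x /=; rewrite subrr.
Qed.

End Lspace_distance.

(** * Lower semicontinuity of the L^r-norm along L^q-convergence *)

Section Lower_semicontinuity.
Context d (S : measurableType d) (R : realType).
Variable mu : {measure set S -> \bar R}.

Lemma cvg_powR (T : Type) (F : set_system T) {FF : Filter F} (u : T -> R) (a r : R) :
  0 < r -> 0 <= a -> (forall x, 0 <= u x) -> u @ F --> a ->
  (fun x => u x `^ r) @ F --> a `^ r.
Proof.
move=> r0; rewrite le_eqVlt => /predU1P[<-|a0] u0 ua.
  rewrite powR0 ?gt_eqF//; apply/cvgr0Pnorm_lt => e e0.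
  have e1 : 0 < e `^ r^-1 by rewrite powR_gt0.
  move/cvgr0Pnorm_lt : ua => /(_ _ e1); apply: filterS => x.
  rewrite !ger0_norm ?powR_ge0// => uxe.
  rewrite -[ltRHS]powRr1 ?ltW// -(mulVf (lt0r_neq0 r0)) powRrM.
  by rewrite gt0_ltr_powR// ?nnegrE// ltW.
apply: (@cvg_comp _ _ _ u (fun y : R => y `^ r) _ _ _ ua).
have /derivable1_diffP/differentiable_continuous : derivable (@powR R ^~ r) a 1.
  by apply: derivable_powR; rewrite in_itv/= a0.
exact.
Qed.

(** The integrals have a finite sum, so the series of the |f n|^q is integrable, hence finite almost
    everywhere, and the terms of a convergent series tend to 0. *)
Lemma ae_cvg_of_Lnorm_small (q : R) (f : nat -> S -> R) : 1 <= q ->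
  (forall n, measurable_fun [set: S] (f n)) ->
  (forall n, (\int[mu]_x (`|f n x| `^ q)%:E <= (1 / (2 ^ n.+1)%:R)%:E)%E) ->
  \forall x \ae mu, f n x @[n --> \oo] --> 0.
Proof.
move=> q1 mf fle.
have q0 : 0 < q by rewrite (lt_le_trans ltr01).
pose g n x := (`|f n x| `^ q)%:E.
have mg n : measurable_fun [set: S] (g n).
  apply/measurable_EFinP/(measurableT_comp (measurable_powR _)).
  exact: measurableT_comp.
have g0 n x : (0 <= g n x)%E by rewrite lee_fin powR_ge0.
have ig : mu.-integrable [set: S] (fun x => (\sum_(n <oo) g n x)%E).
  apply/integrableP; split.
    apply: ge0_emeasurable_sum => // n x _ _; exact: g0.
  rewrite (eq_integral (fun x => (\sum_(n <oo) g n x)%E)); last first.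
    by move=> x _; rewrite gee0_abs// nneseries_ge0.
  rewrite integral_nneseries//.
  apply: le_lt_trans (ltry 1).
  apply: le_trans (epsilon_trick0 xpredT (@ler01 R)).
  by apply: lee_nneseries => n _; [rewrite integral_ge0|exact: fle].
have := integrable_ae measurableT ig; apply: filterS => x /(_ I) fin.
have cv : series (fun n => `|f n x| `^ q) n @[n --> \oo] -->
    fine (\sum_(n <oo) g n x)%E.
  apply: (@fine_cvg _ _ _ _ (fun n => (series (fun n => `|f n x| `^ q) n)%:E)).
  rewrite fineK//.
  have := @is_cvg_nneseries _ (fun n => g n x) xpredT 0 (fun n _ _ => g0 n x).
  by under eq_fun do rewrite sumEFin.
have := cvg_series_cvg_0 (cvgP _ cv) => /cvgrPdist_lt h.
apply/cvgrPdist_lt => e e0.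
have eq0 : 0 < e `^ q by rewrite powR_gt0.
have := h _ eq0; apply: filterS => n.
rewrite !sub0r !normrN [X in X < _ -> _]ger0_norm ?powR_ge0// => lt.
rewrite ltNge; apply/negP => le; move: lt; apply/negP; rewrite -leNgt.
by rewrite ge0_ler_powR// ?nnegrE// ltW.
Qed.

(** For finite r this is Fatou's lemma for |f n|^r. For r infinite, the countably many essential
    bounds hold together off a single null set and pass to the pointwise limit. *)
Lemma Lnorm_lower_semicontinuous (r : \bar R) (f : nat -> S -> R) (g : S -> R) (B : R) :
  (1 <= r)%E -> 0 <= B ->
  (forall n, measurable_fun [set: S] (f n)) -> measurable_fun [set: S] g ->
  (\forall x \ae mu, f n x @[n --> \oo] --> g x) ->
  (forall n, ('N[mu]_r[EFin \o f n] <= B%:E)%E) ->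
  ('N[mu]_r[EFin \o g] <= B%:E)%E.
Proof.
move=> + B0 mf mg fg; case: r => [r r1|_|//] fB.
- rewrite lee_fin in r1; have r0 : 0 < r by rewrite (lt_le_trans ltr01).
  have pw h : ('N[mu]_r%:E[EFin \o h] <= B%:E)%E =
      (\int[mu]_x (`|h x| `^ r)%:E <= (B `^ r)%:E)%E.
    have -> : (\int[mu]_x (`|h x| `^ r)%:E =
        \int[mu]_x (`|(EFin \o h) x| `^ r))%E.
      by apply: eq_integral => x _ /=; rewrite -poweR_EFin.
    rewrite -poweR_Lnorm ?gt_eqF// -poweR_EFin.
    have := Lnorm_ge0 mu r%:E (EFin \o h).
    case: ('N[mu]_r%:E[EFin \o h])%E => [x x0|_|//].
      rewrite !poweR_EFin !lee_fin; apply/idP/idP => [xB|].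
        by apply: ge0_ler_powR; rewrite ?nnegrE// ltW.
      by apply: contraTT; rewrite -!ltNge; apply: gt0_ltr_powR; rewrite ?nnegrE.
    by rewrite poweRyr ?gt_eqF// poweR_EFin.
  rewrite pw.
  have mp (h : S -> R) : measurable_fun setT h ->
      measurable_fun setT (fun x => (`|h x| `^ r)%:E).
    move=> mh; apply/measurable_EFinP/(measurableT_comp (measurable_powR _)).
    exact: measurableT_comp.
  rewrite (_ : (\int[mu]_x _ =
    \int[mu]_x limn_einf (fun n => (`|f n x| `^ r)%:E))%E); last first.
    apply: ge0_ae_eq_integral => //.
    - exact: mp.
    - apply: measurableT_comp => //; apply: measurable_fun_limn_esup => n.
      by apply: measurableT_comp => //; exact: mp.
    - move=> x _; rewrite limn_einf_lim; apply: lime_ge; first exact: is_cvg_einfs.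
      apply: nearW => n; apply: le_ereal_inf_tmp => _ [m _ <-].
      by rewrite /= lee_fin powR_ge0.
    - apply: filterS fg => x fx _; apply/esym.
      have /cvg_limn_einf_sup [] // :
        (`|f n x| `^ r)%:E @[n --> \oo] --> (`|g x| `^ r)%:E.
      apply: cvg_EFin; first exact: nearW.
      by apply: cvg_powR => //; exact: cvg_norm.
  apply: le_trans (fatou mu measurableT (fun n => mp _ (mf n)) _) _ => //.
  rewrite limn_einf_lim; apply: lime_le; first exact: is_cvg_einfs.
  apply: nearW => n; apply: (@le_trans _ _ (\int[mu]_x (`|f n x| `^ r)%:E)%E).
    by apply: ereal_inf_lbound; exists n => /=.
  by rewrite -pw.
- rewrite unlock /Lnorm in fB *; case: ifPn fB => // mu0 fB.
  apply/ess_supP.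
  have /ae_foralln : forall n, \forall x \ae mu, ((abse \o (EFin \o f n)) x <= B%:E)%E.
    by move=> n; apply/ess_supP.
  apply: filterS2 fg => x fx le /=.
  have cvn : `|f n x| @[n --> \oo] --> `|g x| by exact: cvg_norm.
  rewrite lee_fin -(cvg_lim _ cvn)//; apply: limr_le; first exact: cvgP cvn.
  by apply: nearW => n; have := le n.
Qed.

End Lower_semicontinuity.

Section Ldist_limit.
Context d (S : measurableType d) (R : realType).
Variables (mu : {measure set S -> \bar R}) (q : R) (q1 : (1 <= q%:E)%E).
Local Notation Lq := (LspaceType mu q1).

(** Convergence in L^q alone does not give convergence almost everywhere. The approximants are
    therefore chosen with summable errors, which does, and with errors at most [eta], which keeps
    their L^r-distances below B + eta. *)
Lemma Ldist_lower_semicontinuous (r : \bar R) (B : R) (u u' : Lq) :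
  (1 <= r)%E -> 0 <= B ->
  (forall e : R, 0 < e -> exists z z' : Lq,
    [/\ dst z u <= e, dst z' u' <= e & (Ldist mu r z z' <= (B + e)%:E)%E]) ->
  (Ldist mu r u u' <= B%:E)%E.
Proof.
move=> r1 B0 h; apply/lee_addgt0Pr => eta eta0; rewrite -EFinD.
have q1' : 1 <= q by rewrite -lee_fin.
have pow2 n : 0 < (2 ^ n.+1)%:R :> R by rewrite ltr0n expn_gt0.
(* The errors on u and on u' add up in the difference, hence the last division by 2. *)
pose e n := Num.min eta (1 / (2 ^ n.+1)%:R / 2).
have e0 n : 0 < e n by rewrite lt_min eta0/= divr_gt0// divr_gt0.
have /choice[z hz] : forall n, exists zz : Lq * Lq,
    [/\ dst zz.1 u <= e n, dst zz.2 u' <= e n &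
      (Ldist mu r zz.1 zz.2 <= (B + e n)%:E)%E].
  by move=> n; have [z [z' ?]] := h _ (e0 n); exists (z, z').
pose f n : S -> R := ((z n).1 : S -> R) \- (z n).2.
pose g : S -> R := (u : S -> R) \- u'.
have mf n : measurable_fun [set: S] (f n).
  by apply: measurable_funB; exact: measurable_Lspace.
have mg : measurable_fun [set: S] g.
  by apply: measurable_funB; exact: measurable_Lspace.
have fg : \forall x \ae mu, f n x @[n --> \oo] --> g x.
  have small n : (\int[mu]_x (`|(f n \- g)%R x| `^ q)%:E <= (1 / (2 ^ n.+1)%:R)%:E)%E.
    have [h1 h2 _] := hz n.
    have le2 : ('N[mu]_q%:E[EFin \o (f n \- g)%R] <= (1 / (2 ^ n.+1)%:R)%:E)%E.
      apply: (@le_trans _ _ (Ldist mu q%:E (z n).1 u + Ldist mu q%:E u' (z n).2)%E).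
        apply: le_trans (eminkowski mu _ _ q1); last 2 first.
        - by apply: measurable_funB; exact: measurable_Lspace.
        - by apply: measurable_funB; exact: measurable_Lspace.
        rewrite le_eqVlt; apply/orP; left; apply/eqP; apply: eq_Lnorm => x /=.
        by congr EFin; rewrite /f /g /=; ring.
      rewrite !dstE -EFinD lee_fin [dst u' _]dstC (le_trans (lerD h1 h2))//.
      have : e n <= 1 / (2 ^ n.+1)%:R / 2 by rewrite ge_min lexx orbT.
      lra.
    have fin : finite_norm mu q%:E (f n \- g)%R.
      by rewrite /finite_norm (le_lt_trans le2)// ltry.
    rewrite integral_powR_norm// lee_fin.
    have : fine 'N[mu]_q%:E[EFin \o (f n \- g)%R] <= 1 / (2 ^ n.+1)%:R.
      by rewrite -lee_fin fineK// ge0_fin_numE// Lnorm_ge0.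
    set N := fine _ => Nle.
    have N0 : 0 <= N by rewrite fine_ge0// Lnorm_ge0.
    apply: (le_trans _ Nle).
    have [->|Nn0] := eqVneq N 0; first by rewrite powR0// gt_eqF// (lt_le_trans ltr01).
    apply: ge1r_powR => //; rewrite lt0r Nn0 N0/=.
    rewrite (le_trans Nle)// ler_pdivrMr// mul1r ler1n expn_gt0//.
  have := ae_cvg_of_Lnorm_small q1' (fun n => measurable_funB (mf n) mg) small.
  apply: filterS => x fgx.
  rewrite (_ : (fun n => f n x) = (fun n => (f n \- g)%R x + g x)); last first.
    by apply/funext => n /=; rewrite subrK.
  by rewrite -[X in _ --> X]add0r; apply: cvgD => //; exact: cvg_cst.
apply: (Lnorm_lower_semicontinuous r1 _ mf mg fg).
  by rewrite addr_ge0// ltW.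
move=> n; have [_ _ h3] := hz n; apply: le_trans h3 _.
by rewrite lee_fin lerD2l ge_min lexx.
Qed.

End Ldist_limit.

(** * Resolvents and the generated semigroup *)

Section Resolvent.
Context d (S : measurableType d) (R : realType).
Variables (mu : {measure set S -> \bar R}) (q : \bar R) (q1 : (1 <= q)%E).
Local Notation Lq := (LspaceType mu q1).
Variables (omega : R) (A : operator mu q1).
Hypothesis A_acc : accretive (lin_op omega 1 A).
Hypothesis omega_ge0 : 0 <= omega.
Implicit Types (u v w f : Lq) (h : R) (c : nat -> Lq).

(* [u + h v = f] is the same as [u + l (omega u + v) = f / (1 - h omega)] with
   [l = h / (1 - h omega)], which is a resolvent of [omega I + A]. *)
Lemma resolvent_lipschitz h f u f' u' : 0 < h -> h * omega < 1 ->
  resolvent h A (f, u) -> resolvent h A (f', u') ->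
  (1 - h * omega) * dst u u' <= dst f f'.
Proof.
move=> h0 hw; have k0 : 0 < 1 - h * omega by rewrite subr_gt0.
pose l := h / (1 - h * omega).
have l0 : 0 < l by rewrite divr_gt0.
have rescale f1 u1 : resolvent h A (f1, u1) -> exists F : Lq,
    (F : S -> R) = (fun x => (1 - h * omega)^-1 * f1 x) %[ae mu] /\
    resolvent l (lin_op omega 1 A) (F, u1).
  move=> [v Av /= fE].
  have [v2 v2E] := Lspace_lin omega 1 u1 v.
  have [F FE] := Lspace_lin (1 - h * omega)^-1 0 f1 f1.
  exists F; split.
    by apply: filterS FE => x /= /[apply] ->; rewrite mul0r addr0.
  exists v2; first by exists v.
  apply: filterS3 FE fE v2E => x /= F1 f1E v21 _.
  rewrite F1// f1E// v21// /l; field; exact: lt0r_neq0.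
move=> /rescale[F [FE RF]] /rescale[F' [FE' RF']].
have [_ ne] := A_acc l0.
have := ne _ _ _ _ RF RF'.
rewrite [leRHS](_ : _ = ((1 - h * omega)^-1 * dst f f')%:E)%E.
  by rewrite dstE lee_fin mulrC ler_pdivlMr// mulrC.
rewrite EFinM -dstE /Ldist -[in RHS](@gtr0_norm _ (1 - h * omega)^-1) ?invr_gt0//.
rewrite -(LnormZ_Lfun q1); last exact: Lspace_sub_Lfun.
apply: ae_eq_Lnorm => //.
- by apply: measurable_funB; exact: measurable_Lspace.
- by apply: measurable_funM => //; apply: measurable_funB; exact: measurable_Lspace.
- by apply: filterS2 FE FE' => x /= F1 F2 _; rewrite F1// F2// mulrBr.
Qed.

(** Unlike [pow_op], this keeps the intermediate points of the Euler scheme, among which the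
    smoothing effect is found. Only c 0, ..., c n are constrained. *)
Definition chain (B : operator mu q1) n c := forall k, (k < n)%N -> B (c k, c k.+1).

Lemma pow_op_chain (B : operator mu q1) n u x : pow_op B n (u, x) ->
  exists c, [/\ chain B n c, c 0%N = u & c n = x].
Proof.
elim: n u => [|n IH] u /=; first by move=> ->; exists (fun=> x).
move=> [w Bw /IH[c [cc c0 cn]]].
exists (fun k => if k is k'.+1 then c k' else u); split => // -[|k] /= kn.
- by rewrite c0.
- exact: cc.
Qed.

Lemma chain_le (B : operator mu q1) m n c : (m <= n)%N -> chain B n c -> chain B m c.
Proof. by move=> mn cc k km; apply: cc; exact: leq_trans mn. Qed.

Lemma chain_shift (B : operator mu q1) m n c :
  chain B (m + n) c -> chain B n (fun k => c (m + k)%N).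
Proof. by move=> cc k kn; rewrite addnS; apply: cc; rewrite ltn_add2l. Qed.

Lemma chain_lipschitz h n c c' : 0 < h -> h * omega < 1 ->
  chain (resolvent h A) n c -> chain (resolvent h A) n c' ->
  (1 - h * omega) ^+ n * dst (c n) (c' n) <= dst (c 0%N) (c' 0%N).
Proof.
move=> h0 hw; elim: n => [|n IH] cc cc'; first by rewrite expr0 mul1r.
have k0 : 0 < 1 - h * omega by rewrite subr_gt0.
apply: le_trans (IH (chain_le (leqnSn n) cc) (chain_le (leqnSn n) cc')).
rewrite exprSr -mulrA; apply: ler_wpM2l; first by rewrite exprn_ge0// ltW.
exact: (resolvent_lipschitz h0 hw (cc n (ltnSn n)) (cc' n (ltnSn n))).
Qed.

(** Since (u, v) is in A, u is the resolvent of u + h v, so the first step has length at most h |v|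
    / (1 - h omega). The chain shifted by one index is again a chain, and comparing it with the
    original one bounds step k by (1 - h omega)^(-k) times the first step. The constant E absorbs
    all these powers up to n. *)
Lemma chain_time_lipschitz h n c u v E : 0 < h -> h * omega < 1 ->
  A (u, v) -> c 0%N = u -> chain (resolvent h A) n c ->
  1 <= E * (1 - h * omega) ^+ n ->
  forall k i, (k + i <= n)%N ->
    dst (c k) (c (k + i)%N) <= i%:R * (E * h * fine 'N[mu]_q[EFin \o v]%E).
Proof.
move=> h0 hw Auv c0 cc hE.
set Nv := fine _.
have Nv0 : 0 <= Nv by rewrite fine_ge0// Lnorm_ge0.
have k0 : 0 < 1 - h * omega by rewrite subr_gt0.
have k1 : 1 - h * omega <= 1 by rewrite gerBl mulr_ge0// ltW.
have step k : (k < n)%N -> dst (c k) (c k.+1) <= E * h * Nv.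
  move=> kn.
  have [f fE] := Lspace_lin 1 h u v.
  have Rf : resolvent h A (f, u) by exists v.
  have fu : dst f u = h * Nv.
    apply/EFin_inj; rewrite -dstE EFinM -[in RHS](@gtr0_norm _ h)//.
    rewrite fineK; last first.
      rewrite ge0_fin_numE ?Lnorm_ge0//; exact: Lebesgue_finite.
    rewrite -(LnormZ_Lfun q1); last exact: Lspace_Lfun.
    apply: ae_eq_Lnorm => //.
    - by apply: measurable_funB; exact: measurable_Lspace.
    - by apply: measurable_funM => //; exact: measurable_Lspace.
    - by apply: filterS fE => x /= /[apply] ->; rewrite mul1r addrAC subrr add0r.
  have R0 : resolvent h A (u, c 1%N) by rewrite -c0; apply: cc; exact: leq_ltn_trans kn.
  have le1 := resolvent_lipschitz h0 hw Rf R0.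
  have le2 := chain_lipschitz h0 hw (chain_le (ltnW kn) cc)
    (@chain_shift _ 1 k _ (chain_le kn cc)).
  rewrite /= !add1n c0 in le2.
  have le3 : (1 - h * omega) ^+ k.+1 * dst (c k) (c k.+1) <= h * Nv.
    rewrite exprS -mulrA -fu; apply: le_trans le1.
    by rewrite ler_wpM2l// ltW.
  have le4 : (1 - h * omega) ^+ n <= (1 - h * omega) ^+ k.+1.
    by apply: ler_wiXn2l => //; exact: ltW.
  have E0 : 0 <= E.
    rewrite leNgt; apply/negP => E0; have := exprn_ge0 n (ltW k0); nra.
  have D0 := dst_ge0 (c k) (c k.+1).
  rewrite -mulrA; apply: le_trans (ler_wpM2l E0 le3).
  rewrite mulrA -[leLHS]mul1r ler_wpM2r// (le_trans hE)// ler_wpM2l//.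
move=> k; elim=> [_|i IH kin].
  by rewrite addn0 dstuu mul0r.
rewrite addnS in kin *.
apply: le_trans (dst_triangle (c (k + i)%N) _ _) _.
by rewrite -natr1 mulrDl mul1r lerD// ?IH ?step// ltnW.
Qed.

End Resolvent.

(** Chains over the times j tau and with j N steps share the step tau/N for every j. Statements
    about a large number n of steps are thus used along multiples n = j N with a common N. *)
Lemma near_mulnl (m : nat) (P : nat -> Prop) : (0 < m)%N ->
  (\forall n \near \oo, P n) -> \forall N \near \oo, P (m * N)%N.
Proof.
move=> m0 [N0 _ H]; exists N0 => // N /= N0N; apply: H => /=.
by rewrite (leq_trans N0N)// leq_pmull.
Qed.

Lemma near_bounded_forall (m : nat) (P : nat -> nat -> Prop) :
  (forall j, (j <= m)%N -> \forall n \near \oo, P j n) ->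
  \forall n \near \oo, forall j, (j <= m)%N -> P j n.
Proof.
elim: m => [|m IH] H.
  by have := H 0%N (leqnn _); apply: filterS => n Pn j; rewrite leqn0 => /eqP ->.
have := IH (fun j jm => H j (leq_trans jm (leqnSn m))).
apply: filterS2 (H m.+1 (leqnn _)) => n Pm Pn j.
by rewrite leq_eqVlt => /predU1P[->//|/Pn].
Qed.

(** * The semigroup compared with its Euler chains *)

Section Semigroup.
Context d (S : measurableType d) (R : realType).
Variables (mu : {measure set S -> \bar R}) (q : \bar R) (q1 : (1 <= q)%E).
Local Notation Lq := (LspaceType mu q1).
Variables (omega : R) (A : operator mu q1).
Hypothesis A_acc : accretive (lin_op omega 1 A).
Hypothesis omega_ge0 : 0 <= omega.
Variable T : R -> Lq -> Lq.
Hypothesis T_gen : generated_semigroup A T.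
Implicit Types (u v w y : Lq) (t tau e : R) (c : nat -> Lq).

Lemma dom_closure u : dom A u -> Lq_closure (dom A) u.
Proof. by move=> Au e e0; exists u => //; rewrite dstE dstuu lte_fin. Qed.

Lemma near_divn_lt t e : 0 < e -> \forall n \near \oo, t / n%:R < e.
Proof.
move=> e0; near=> n.
have n0 : 0 < n%:R :> R by rewrite ltr0n; near: n; exists 1%N.
rewrite ltr_pdivrMr// -ltr_pdivrMl// mulrC.
by near: n; exact: nbhs_infty_gtr.
Unshelve. all: by end_near. Qed.

Lemma near_step_lt1 t : \forall n \near \oo, t / n%:R * omega < 1.
Proof.
by have := near_divn_lt (t * omega) (@ltr01 R); apply: filterS => n; rewrite mulrAC.
Qed.

Lemma near_expR_le t e : 0 <= t -> 0 < e ->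
  \forall n \near \oo, expR (- (t * omega * (1 + e))) <= (1 - t / n%:R * omega) ^+ n.
Proof.
move=> t0 e0; near=> n.
rewrite (mulrAC t _^-1); apply: expR_le_exprn => //; first exact: mulr_ge0.
rewrite -ler_pdivrMl//.
by near: n; exact: nbhs_infty_ger.
Unshelve. all: by end_near. Qed.

(** The definition of the semigroup provides one chain for each large n. By [chain_lipschitz] with
    equal starting points any other chain from u has the same endpoint, up to distance 0, so the
    estimate holds for all of them. *)
Lemma semigroup_approx u t e : Lq_closure (dom A) u -> 0 < t -> 0 < e ->
  \forall n \near \oo,
    (exists c, chain (resolvent (t / n%:R) A) n c /\ c 0%N = u) /\
    (forall c, chain (resolvent (t / n%:R) A) n c -> c 0%N = u ->
      dst (c n) (T t u) <= e).
Proof.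
move=> clu t0 e0; have [_ /(_ _ t0)[x [px xT]]] := T_gen clu.
near=> n.
have n0 : 0 < n%:R :> R by rewrite ltr0n; near: n; exists 1%N.
have hw : t / n%:R * omega < 1 by near: n; exact: near_step_lt1.
have h0 : 0 < t / n%:R by rewrite divr_gt0.
have /pow_op_chain[c [cc c0 cn]] : pow_op (resolvent (t / n%:R) A) n (u, x n).
  by near: n.
split; first by exists c.
move=> c' cc' c'0; rewrite (le_trans (dst_triangle (x n) _ _))//.
have := chain_lipschitz A_acc h0 hw cc' cc.
rewrite c'0 c0 cn dstuu pmulr_rle0 ?exprn_gt0 ?subr_gt0// => d0.
rewrite -[leRHS]add0r lerD//.
suff : (Ldist mu q (x n) (T t u) < e%:E)%E by rewrite dstE lte_fin => /ltW.
near: n; move/fine_cvgP : xT => [_ /cvgr0Pnorm_lt/(_ _ e0)].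
apply: filterS => n /=.
by rewrite ger0_norm ?dst_ge0// dstE lte_fin.
Unshelve. all: by end_near. Qed.

(** A crude bound for (1 - t omega / n)^(-n), valid for large n: the case e = 1 of [near_expR_le].
    It only multiplies errors that are made small; the sharp exponent of the final estimate comes
    from [near_expR_le] with e tending to 0. *)
Let E t := expR (2 * t * omega).

Lemma near_growth t : 0 <= t ->
  \forall n \near \oo, 1 <= E t * (1 - t / n%:R * omega) ^+ n.
Proof.
move=> t0; have := near_expR_le t0 (@ltr01 R); apply: filterS => n le.
rewrite /E -[leLHS](expRxMexpNx_1 (2 * t * omega)) ler_wpM2l ?expR_ge0//.
by apply: le_trans le; rewrite ler_expR; lra.
Qed.

Lemma near_step t : 0 <= t -> \forall n \near \oo,
  [/\ (0 < n)%N, t / n%:R * omega < 1 & 1 <= E t * (1 - t / n%:R * omega) ^+ n].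
Proof.
move=> t0; have pos := nbhs_infty_gt 0.
by apply: filterS3 pos (near_step_lt1 t) (near_growth t0).
Qed.

Lemma semigroup_lipschitz u u' t : Lq_closure (dom A) u -> Lq_closure (dom A) u' ->
  0 < t -> dst (T t u) (T t u') <= E t * dst u u'.
Proof.
move=> clu clu' t0; apply/ler_addgt0Pr => e e0.
have e20 : 0 < e / 2 by rewrite divr_gt0.
have [n [[n0' hw gr] [[[c [cc c0]] /(_ c cc c0) d1]
    [[c' [cc' c'0]] /(_ c' cc' c'0) d2]]]] :=
  filter_ex (filterI (near_step (ltW t0))
    (filterI (semigroup_approx clu t0 e20) (semigroup_approx clu' t0 e20))).
have n0 : 0 < n%:R :> R by rewrite ltr0n.
have h0 : 0 < t / n%:R by rewrite divr_gt0.
have := chain_lipschitz A_acc h0 hw cc cc'.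
rewrite c0 c'0 => lip.
have := dst_triangle (c n) (T t u) (T t u'); have := dst_triangle (c' n) (c n) (T t u').
rewrite (dstC (T t u) (c n)).
have : dst (c n) (c' n) <= E t * dst u u'.
  apply: le_trans (ler_wpM2l (expR_ge0 _) lip).
  by rewrite mulrA -[leLHS]mul1r ler_wpM2r// dst_ge0.
lra.
Qed.

(** This takes the place of the semigroup law. A chain from u with (a + b) N steps of size tau/N
    passes near T (a tau) u after a N steps; its remaining b N steps form a chain that is compared
    with the one from y. *)
Lemma semigroup_comparison u y tau a b : Lq_closure (dom A) u ->
  Lq_closure (dom A) y -> 0 < tau -> (0 < a)%N -> (0 < b)%N ->
  dst (T (b%:R * tau) y) (T ((a + b)%:R * tau) u) <=
  E ((a + b)%:R * tau) * dst y (T (a%:R * tau) u).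
Proof.
move=> clu cly tau0 a0 b0; set t := (a + b)%:R * tau.
have t0 : 0 < t by rewrite mulr_gt0// ltr0n addn_gt0 a0.
apply/ler_addgt0Pr => e e0.
have E0 : 0 < E t by exact: expR_gt0.
(* Two endpoint errors count once, and the error at time a tau is multiplied by E t. *)
pose e' := e / (2 + E t).
have e'0 : 0 < e' by rewrite divr_gt0// addr_gt0.
have steps k N : (0 < k)%N -> (0 < N)%N -> k%:R * tau / (k * N)%:R = tau / N%:R.
  move=> k0 N0; rewrite natrM; field.
  by rewrite !pnatr_eq0 -!lt0n k0 N0.
have ta0 : 0 < a%:R * tau by rewrite mulr_gt0// ltr0n.
have tb0 : 0 < b%:R * tau by rewrite mulr_gt0// ltr0n.
have ab0 : (0 < a + b)%N by rewrite addn_gt0 a0.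
have [N [[abN0 hw gr] [[_ Ha] [[[cy [ccy cy0]] Hb] [[c [cc c0]] H]]]]] :=
  filter_ex (filterI (near_mulnl ab0 (near_step (ltW t0)))
    (filterI (near_mulnl a0 (semigroup_approx clu ta0 e'0))
    (filterI (near_mulnl b0 (semigroup_approx cly tb0 e'0))
      (near_mulnl ab0 (semigroup_approx clu t0 e'0))))).
have N0 : (0 < N)%N by move: abN0; rewrite muln_gt0 => /andP[].
have d1 := Hb cy ccy cy0.
have d2 := H c cc c0.
rewrite /t !steps// in cc gr hw Ha ccy.
have h0 : 0 < tau / N%:R by rewrite divr_gt0// ltr0n.
rewrite mulnDl in cc d2.
have d3 := Ha c (chain_le (leq_addr _ _) cc) c0.
have lip := chain_lipschitz A_acc h0 hw ccy (chain_shift cc).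
rewrite addn0 cy0 in lip.
have k0 : 0 < 1 - tau / N%:R * omega by rewrite subr_gt0.
have k1 : 1 - tau / N%:R * omega <= 1 by rewrite gerBl mulr_ge0// ltW.
have gr' : 1 <= E t * (1 - tau / N%:R * omega) ^+ (b * N).
  apply: le_trans gr _; rewrite ler_wpM2l ?expR_ge0//.
  by apply: ler_wiXn2l; [exact: ltW|exact: k1|rewrite leq_mul2r leq_addl orbT].
have d4 : dst (cy (b * N)%N) (c (a * N + b * N)%N) <= E t * dst y (c (a * N)%N).
  apply: le_trans (ler_wpM2l (ltW E0) lip).
  by rewrite mulrA -[leLHS]mul1r ler_wpM2r// dst_ge0.
have d5 : E t * dst y (c (a * N)%N) <= E t * dst y (T (a%:R * tau) u) + E t * e'.
  rewrite -mulrDr ler_wpM2l ?(ltW E0)//.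
  rewrite (le_trans (dst_triangle (T (a%:R * tau) u) _ _))//.
  by rewrite lerD2l dstC.
have ee : e = 2 * e' + E t * e'.
  by rewrite -mulrDl /e' mulrC divfK// gt_eqF// addr_gt0.
have := dst_triangle (cy (b * N)%N) (T (b%:R * tau) y) (T t u).
have := dst_triangle (c (a * N + b * N)%N) (cy (b * N)%N) (T t u).
rewrite (dstC (T (b%:R * tau) y) (cy _)).
lra.
Qed.

(* The chain issued from [u] is Lipschitz in time, so that [c k.+1] is close to
   the semigroup at the end of the block of [N] steps containing [k]. *)
Lemma semigroup_blocks u t e : dom A u -> 0 < t -> 0 < e ->
  \forall m \near \oo, \forall N \near \oo,
    exists c, [/\ chain (resolvent (t / m%:R / N%:R) A) (m * N)%N c, c 0%N = u &
    forall k, (k < m * N)%N ->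
      dst (T ((m - (k %/ N).+1)%:R * (t / m%:R)) (c k.+1)) (T t u) <= e].
Proof.
move=> [[u0 v] /= Auv <-{u}] t0 e0; set u := u0 in Auv *.
have clu : Lq_closure (dom A) u by apply: dom_closure; exists (u, v).
have E0 : 0 < E t by exact: expR_gt0.
have E1 : 1 <= E t by rewrite -expR0 ler_expR !mulr_ge0// ltW.
set L := fine 'N[mu]_q[EFin \o v]%E.
have L0 : 0 <= L by rewrite fine_ge0// Lnorm_ge0.
near=> m.
have m0 : (0 < m)%N by near: m; exists 1%N.
have m0R : 0 < m%:R :> R by rewrite ltr0n.
set tau := t / m%:R.
have tau0 : 0 < tau by rewrite divr_gt0.
(* Within one block of duration tau the chain moves by at most E t * tau * L, and
   [semigroup_comparison] multiplies this by E t. This fixes how large m must be. *)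
have small : E t * (E t * tau * L) <= e / 2.
  rewrite (_ : E t * _ = (E t * E t * t * L) / m%:R); last first.
    by rewrite /tau; field; rewrite gt_eqF.
  by apply/ltW; near: m; apply: near_divn_lt; rewrite divr_gt0.
have mtau : m%:R * tau = t by rewrite /tau mulrC divfK// gt_eqF.
pose e' := e / 2 / E t.
have e'0 : 0 < e' by rewrite !divr_gt0.
(* For m fixed there are finitely many block ends j tau, so one N serves them all. *)
have blocks : \forall N \near \oo, forall j, (j <= m)%N -> (0 < j)%N ->
  forall c, chain (resolvent (j%:R * tau / (j * N)%:R) A) (j * N)%N c -> c 0%N = u ->
      dst (c (j * N)%N) (T (j%:R * tau) u) <= e'.
  apply: near_bounded_forall => j _; case: (posnP j) => [->|j0]; first exact: nearW.
  have tj0 : 0 < j%:R * tau by rewrite mulr_gt0// ltr0n.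
  have := near_mulnl j0 (semigroup_approx clu tj0 e'0).
  by apply: filterS => N' [].
have params := near_mulnl m0 (near_step (ltW t0)).
have chains := near_mulnl m0 (semigroup_approx clu t0 e'0).
apply: filterS3 params blocks chains.
move=> N [mN0 hw gr] Hj [[c [cc c0]] _].
have N0 : (0 < N)%N by move: mN0; rewrite muln_gt0 => /andP[].
have N0R : 0 < N%:R :> R by rewrite ltr0n.
have steps k : (0 < k)%N -> k%:R * tau / (k * N)%:R = tau / N%:R.
  move=> k0; rewrite natrM; field.
  by rewrite !pnatr_eq0 -!lt0n k0 N0.
rewrite -{1}mtau steps// in cc.
rewrite -{1}mtau steps// in hw.
rewrite -{2}mtau steps// in gr.
have h0 : 0 < tau / N%:R by rewrite divr_gt0.
exists c; split => // k kmN.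
have {}Hj j : (j <= m)%N -> (0 < j)%N ->
    dst (c (j * N)%N) (T (j%:R * tau) u) <= e'.
  move=> jm j0; apply: Hj => //; rewrite steps//; apply: chain_le cc.
  by rewrite leq_mul2r jm orbT.
(* The index a N is the first block end at or after k + 1; it is at most m N because k < m N. *)
set a := (k %/ N).+1.
have am : (a <= m)%N by rewrite /a ltn_divLR.
have kaN : (k.+1 <= a * N)%N by rewrite /a -ltn_divLR.
have aNk : (a * N - k.+1 <= N)%N.
  by rewrite /a {2}(divn_eq k N) mulSn leq_subLR; lia.
have near1 : dst (c k.+1) (c (a * N)%N) <= E t * tau * L.
  have aNmN : (a * N <= m * N)%N by rewrite leq_mul2r am orbT.
  have := @chain_time_lipschitz _ _ _ mu q q1 omega A A_acc omega_ge0 _ _ c u v _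
    h0 hw Auv c0 cc gr k.+1 (a * N - k.+1)%N.
  rewrite subnKC// => /(_ aNmN) le; apply: le_trans le _.
  rewrite -/L (_ : E t * tau * L = N%:R * (E t * (tau / N%:R) * L)); last first.
    by field; rewrite gt_eqF.
  by rewrite ler_wpM2r ?ler_nat// !mulr_ge0// ltW.
have near2 : dst (c k.+1) (T (a%:R * tau) u) <= E t * tau * L + e'.
  by apply: le_trans (dst_triangle (c (a * N)%N) _ _) _; rewrite lerD// Hj.
have fin : E t * dst (c k.+1) (T (a%:R * tau) u) <= e.
  apply: le_trans (ler_wpM2l (ltW E0) near2) _.
  rewrite mulrDr /e' (_ : E t * (e / 2 / E t) = e / 2); first lra.
  by field; rewrite gt_eqF.
have clk : Lq_closure (dom A) (c k.+1).
  by apply: dom_closure; have [w Aw _] := cc k kmN; exists (c k.+1, w).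
(* In the last block the remaining time is 0, where T is the identity; [semigroup_comparison]
   handles positive remaining times. *)
apply: le_trans fin; move: am; rewrite leq_eqVlt => /predU1P[am|am].
  rewrite am subnn mul0r mtau.
  have [-> _] := T_gen clk.
  by rewrite -[leLHS]mul1r ler_wpM2r// dst_ge0.
have bm0 : (0 < m - a)%N by rewrite subn_gt0.
have := semigroup_comparison clu clk tau0 (isT : (0 < a)%N) bm0.
by rewrite (subnKC (ltnW am)) mtau.
Unshelve. all: by end_near. Qed.

End Semigroup.

(** * The smoothing estimate *)

(** The inequalities weighted by kappa^k have a sum of right-hand sides at most K P b 0, and all
    weights are at least kappa^n. So the n numbers h kappa^n y k have sum at most K P b 0, and one
    of them is at most the mean. Replacing p k by P requires the differences b k - kappa b (k + 1)
    to be nonnegative. *)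
Lemma telescoping_min (R : realFieldType) (n : nat) (h K P kappa : R)
    (b y p : nat -> R) :
  (0 < n)%N -> 0 < kappa -> kappa <= 1 -> 0 < h -> 0 <= K -> 0 <= P ->
  (forall k, 0 <= b k) -> (forall k, 0 <= y k) ->
  (forall k, (k < n)%N -> kappa * b k.+1 <= b k) ->
  (forall k, (k < n)%N -> p k <= P) ->
  (forall k, (k < n)%N -> h * y k <= K * (b k - kappa * b k.+1) * p k) ->
  exists2 k, (k < n)%N & n%:R * h * kappa ^+ n * y k <= K * P * b 0%N.
Proof.
move=> n0 k0 k1 h0 K0 P0 b0 y0 bD pP hy.
apply: contrapT => H.
have {}H k : (k < n)%N -> K * P * b 0%N < n%:R * h * kappa ^+ n * y k.
  by move=> kn; rewrite ltNge; apply/negP => le; apply: H; exists k.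
have sum_le m : (m <= n)%N ->
    \sum_(k < m) (h * kappa ^+ n * y k) <= K * P * (b 0%N - kappa ^+ m * b m).
  elim: m => [_|m IH mn]; first by rewrite big_ord0 expr0 mul1r subrr mulr0.
  rewrite big_ord_recr/=; apply: le_trans (lerD (IH (ltnW mn)) (lexx _)) _.
  have km0 : 0 <= kappa ^+ m by rewrite exprn_ge0// ltW.
  have D0 : 0 <= b m - kappa * b m.+1 by rewrite subr_ge0 bD.
  have le1 : h * y m <= K * P * (b m - kappa * b m.+1).
    rewrite (le_trans (hy _ mn))// [leRHS]mulrAC ler_wpM2l ?pP//.
    exact: mulr_ge0.
  have le2 : h * kappa ^+ n * y m <= kappa ^+ m * (h * y m).
    rewrite mulrAC [leRHS]mulrC ler_wpM2l//; first by rewrite mulr_ge0// ltW.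
    by apply: ler_wiXn2l => //; [exact: ltW|exact: ltnW].
  have := ler_wpM2l km0 le1; rewrite exprS; move: le2; lra.
have := sum_le n (leqnn _).
have KP0 : 0 <= K * P by exact: mulr_ge0.
have : K * P * b 0%N < \sum_(k < n) (h * kappa ^+ n * y k).
  have n0R : 0 < n%:R :> R by rewrite ltr0n.
  have -> : K * P * b 0%N = \sum_(k < n) (K * P * b 0%N / n%:R).
    by rewrite sumr_const card_ord -[RHS]mulr_natr divfK// gt_eqF.
  apply: ltr_sum; first by apply/hasP; exists (Ordinal n0); rewrite ?mem_index_enum.
  move=> k _; rewrite ltr_pdivrMr//; apply: lt_le_trans (H k (ltn_ord k)) _.
  by rewrite le_eqVlt; apply/orP; left; apply/eqP; ring.
have : 0 <= K * P * (kappa ^+ n * b n) by rewrite !mulr_ge0// exprn_ge0// ltW.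
lra.
Qed.

Section Smoothing.
Context d (S : measurableType d) (R : realType).
Variables (mu : {measure set S -> \bar R}) (q : R) (q1 : (1 <= q%:E)%E).
Local Notation Lq := (LspaceType mu q1).
Variables (omega : R) (omega_ge0 : 0 <= omega).
Variables (A : operator mu q1) (A_acc : accretive (lin_op omega 1 A)).
Variables (r : \bar R) (r1 : (1 <= r)%E) (rho sigma C : R).
Hypotheses (rho_ge0 : 0 <= rho) (sigma_gt0 : 0 < sigma) (C_gt0 : 0 < C).
Hypothesis domA_Lr : exists2 u : Lq, dom A u & finite_norm mu r u.
Hypothesis GN : forall u v u' v' : Lq, A (u, v) -> A (u', v') ->
    (Ldist mu r u u' `^ sigma <=
     C%:E *
     (bracket mu q (u \- u')%R (v \- v')%R + omega%:E * Ldist mu q%:E u u' `^ q) *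
     Ldist mu q%:E u u' `^ rho)%E.
Variable T : R -> Lq -> Lq.
Hypothesis T_gen : generated_semigroup A T.
Hypothesis T_growth : forall (u u' : Lq) (t : R),
    Lq_closure (dom A) u -> Lq_closure (dom A) u' ->
    finite_norm mu r u -> finite_norm mu r u' -> 0 < t ->
    (Ldist mu r (T t u) (T t u') <=
     (expR (omega * t))%:E * Ldist mu r u u')%E.
Implicit Types (u f : Lq) (h t e : R).

(** Since f - f' = (u - u') + h (v - v') almost everywhere, [bracket_le] bounds the bracket in [GN]
    by a difference quotient of q-th powers. The resulting bound is finite, and sigma > 0, so the
    L^r-distance of u and u' is a real number x. *)
Lemma resolvent_step h f u f' u' : 0 < h ->
  resolvent h A (f, u) -> resolvent h A (f', u') ->
  exists2 x : R, Ldist mu r u u' = x%:E & 0 <= x /\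
    h * x `^ sigma <=
    C / q * (dst f f' `^ q - (1 - h * (q * omega)) * dst u u' `^ q) * dst u u' `^ rho.
Proof.
move=> h0 [v Auv /= fE] [v' Auv' /= fE'].
have q0 : 0 < q by rewrite (lt_le_trans ltr01)// -lee_fin.
have q1' : 1 <= q by rewrite -lee_fin.
set a := dst u u'; set b := dst f f'.
have mu_ : measurable_fun [set: S] ((u : S -> R) \- u')%R.
  by apply: measurable_funB; exact: measurable_Lspace.
have mv_ : measurable_fun [set: S] ((v : S -> R) \- v')%R.
  by apply: measurable_funB; exact: measurable_Lspace.
have ff : ('N[mu]_q%:E[EFin \o
    (fun x => (((u : S -> R) \- u') x + h * ((v : S -> R) \- v') x)%R)] = b%:E)%E.
  rewrite -dstE; apply: ae_eq_Lnorm => //.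
  - by apply: measurable_funD => //; exact: measurable_funM.
  - by apply: measurable_funB; exact: measurable_Lspace.
  - apply: filterS2 fE fE' => x /= F F' _; rewrite F// F'//; ring.
have br := @bracket_le _ _ _ mu _ _ _ _ q1' h0 mu_ mv_.
have {}br : (bracket mu q ((u : S -> R) \- u')%R ((v : S -> R) \- v')%R <=
    ((q * h)^-1 * (b `^ q - a `^ q))%:E)%E.
  have := br; rewrite ff /=; apply.
  - by rewrite /finite_norm -/(Ldist mu q%:E u u') dstE ltry.
  - by rewrite /finite_norm ff ltry.
have bound : (Ldist mu r u u' `^ sigma <=
    (C * ((q * h)^-1 * (b `^ q - a `^ q) + omega * a `^ q) * a `^ rho)%:E)%E.
  apply: le_trans (GN Auv Auv') _; rewrite dstE !poweR_EFin.
  rewrite !EFinM; apply: lee_wpmul2r; first by rewrite lee_fin powR_ge0.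
  apply: lee_wpmul2l; first by rewrite lee_fin ltW.
  by rewrite EFinD EFinM leeD2r.
have : (0 <= Ldist mu r u u')%E by exact: Lnorm_ge0.
case: (Ldist mu r u u') bound => [x| |//].
- rewrite poweR_EFin !lee_fin => le x0; exists x => //; split => //.
  apply: le_trans (ler_wpM2l (ltW h0) le) _.
  rewrite le_eqVlt; apply/orP; left; apply/eqP; field.
  by rewrite !gt_eqF.
- by rewrite poweRyr ?gt_eqF// leye_eq.
Qed.

(** If (u, v) is in A, then u is a resolvent of u + v with step 1, so [resolvent_step] puts any two
    points of D(A) at finite L^r-distance. One point of D(A) in L^r then brings in all the
    others. *)
Lemma dom_finite_norm u : dom A u -> finite_norm mu r u.
Proof.
move=> [[u1 v] /= Auv <-{u}]; have [u0 [[u2 v0] /= Auv0 <-{u0}] fu0] := domA_Lr.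
have [f fE] := Lspace_lin 1 1 u1 v; have [f0 f0E] := Lspace_lin 1 1 u2 v0.
have [||x xE _] := @resolvent_step 1 f u1 f0 u2 ltr01; [by exists v|by exists v0|].
rewrite /finite_norm.
rewrite (@eq_Lnorm _ _ _ _ _ _ (EFin \o ((u1 \- u2)%R \+ u2)%R)); last first.
  by move=> y /=; rewrite subrK.
apply: le_lt_trans (eminkowski mu _ _ r1) _.
- by apply: measurable_funB; exact: measurable_Lspace.
- exact: measurable_Lspace.
- by rewrite lte_add_pinfty// -/(Ldist mu r u1 u2) xE ltry.
Qed.

Let gamma := (q + rho) / sigma.

(** The approximants are T s (c k.+1) and T s (c' k.+1), where k comes from [telescoping_min] and s
    is the time left after the block of step k. The parameter e measures both the distance to the
    semigroup and the loss in the exponential. *)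
Lemma dom_approx u u' t e : dom A u -> dom A u' -> 0 < t -> 0 < e ->
  exists z z' : Lq, [/\ dst z (T t u) <= e, dst z' (T t u') <= e &
    (Ldist mu r z z' <= ((C / q) `^ sigma^-1 * t `^ (- sigma^-1) *
      expR (omega * t * (1 + gamma * (1 + e))) * dst u u' `^ gamma)%:E)%E].
Proof.
move=> Au Au' t0 e0.
have q0 : 0 < q by rewrite (lt_le_trans ltr01)// -lee_fin.
have q1' : 1 <= q by rewrite -lee_fin.
have qw0 : 0 <= q * omega by rewrite mulr_ge0// ltW.
have wqw : omega <= q * omega by rewrite -[leLHS]mul1r ler_wpM2r.
have [m [m0 Hm]] := filter_ex (filterI (nbhs_infty_gt 0)
  (filterI (semigroup_blocks A_acc omega_ge0 T_gen Au t0 e0)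
    (semigroup_blocks A_acc omega_ge0 T_gen Au' t0 e0))).
have [Hu Hu'] := Hm.
have m0R : 0 < m%:R :> R by rewrite ltr0n.
(* [H1] makes kappa = 1 - q omega h positive and, as omega <= q omega, also gives h omega < 1. [gr]
   controls the growth of the distances along the chains, [grq] the factor kappa^n. *)
have [N [[N0 H1] [[[c [cc c0 Hc]] [c' [cc' c'0 Hc']]] [gr grq]]]] :=
  filter_ex (filterI
    (filterI (nbhs_infty_gt 0) (near_mulnl m0 (near_step_lt1 (q * omega) t)))
    (filterI (filterI Hu Hu')
    (filterI (near_mulnl m0 (near_expR_le omega_ge0 (ltW t0) e0))
      (near_mulnl m0 (near_expR_le qw0 (ltW t0) e0))))).
have N0R : 0 < N%:R :> R by rewrite ltr0n.
set n := (m * N)%N in cc cc' Hc Hc' H1 gr grq.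
have n0 : (0 < n)%N by rewrite muln_gt0 m0.
have n0R : 0 < n%:R :> R by rewrite ltr0n.
set h := t / n%:R in H1 gr grq.
have hE : t / m%:R / N%:R = h by rewrite /h natrM invfM mulrA.
rewrite hE in cc cc'.
have h0 : 0 < h by rewrite divr_gt0.
have nh : n%:R * h = t by rewrite /h mulrC divfK// gt_eqF.
set kappa := 1 - h * (q * omega) in grq.
have kap0 : 0 < kappa by rewrite subr_gt0.
have kap1 : kappa <= 1 by rewrite gerBl mulr_ge0// ltW.
have hw : h * omega < 1 by rewrite (le_lt_trans _ H1)// ler_wpM2l// ltW.
have th0 : 0 < 1 - h * omega by rewrite subr_gt0.
have th1 : 1 - h * omega <= 1 by rewrite gerBl mulr_ge0// ltW.
set a := fun k => dst (c k) (c' k).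
have a0 k : 0 <= a k by exact: dst_ge0.
set G := expR (t * omega * (1 + e)).
have aG k : (k <= n)%N -> a k <= G * a 0%N.
  move=> kn; rewrite -ler_pdivrMl ?expR_gt0// -expRN.
  apply: le_trans (chain_lipschitz A_acc h0 hw (chain_le kn cc) (chain_le kn cc')).
  rewrite ler_wpM2r// (le_trans gr)//.
  by apply: ler_wiXn2l => //; exact: ltW.
have /choice[x hx] : forall k, exists x : R, (k < n)%N ->
    [/\ Ldist mu r (c k.+1) (c' k.+1) = x%:E, 0 <= x &
    h * x `^ sigma <= C / q * (a k `^ q - kappa * a k.+1 `^ q) * a k.+1 `^ rho].
  move=> k; case: (ltnP k n) => kn; last by exists 0.
  by have [x ? [? ?]] := resolvent_step h0 (cc k kn) (cc' k kn); exists x.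
have [|||||k kn le] := @telescoping_min R n h (C / q) ((G * a 0%N) `^ rho) kappa
  (fun k => a k `^ q) (fun k => x k `^ sigma) (fun k => a k.+1 `^ rho)
  n0 kap0 kap1 h0 (ltW (divr_gt0 C_gt0 q0)) (powR_ge0 _ _).
- by move=> k; exact: powR_ge0.
- by move=> k; exact: powR_ge0.
(* The weighted q-th powers decrease: kappa <= (1 - h omega)^q by Bernoulli, and one resolvent step
   has Lipschitz constant 1/(1 - h omega). *)
- move=> k kn; have lip := resolvent_lipschitz A_acc h0 hw (cc k kn) (cc' k kn).
  apply: (@le_trans _ _ ((1 - h * omega) `^ q * a k.+1 `^ q)).
    rewrite ler_wpM2r ?powR_ge0// /kappa mulrCA.
    by apply: bernoulli_powR => //; exact: ltW.
  rewrite -powRM ?(ltW th0)//; apply: ge0_ler_powR; rewrite ?nnegrE ?(ltW q0)//.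
  by rewrite mulr_ge0// ltW.
- move=> k kn; apply: ge0_ler_powR; rewrite ?nnegrE//; last exact: aG.
  by rewrite mulr_ge0// expR_ge0.
- by move=> k /hx[].
have [xE x0 _] := hx k kn.
rewrite nh in le.
set a00 := a 0%N in le aG.
have a000 : 0 <= a00 by exact: a0.
(* In the exponent, q comes from kappa^n and rho from the bound G on the distances; the root of
   order sigma turns q + rho into gamma. *)
pose Y := C / q * t^-1 * expR (omega * t * ((q + rho) * (1 + e))) * a00 `^ (q + rho).
have xY : x k `^ sigma <= Y.
  have qr : a00 `^ (q + rho) = a00 `^ q * a00 `^ rho.
    by rewrite powRD// gt_eqF ?implyFb// ltr_pwDl.
  have Grho : (G * a00) `^ rho = expR (t * omega * (1 + e) * rho) * a00 `^ rho.
    by rewrite powRM ?expR_ge0// /G -expRM.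
  rewrite Grho in le.
  rewrite -(@ler_pM2l _ (t * expR (- (t * (q * omega) * (1 + e))))); last first.
    by rewrite mulr_gt0// expR_gt0.
  apply: (@le_trans _ _ (t * kappa ^+ n * x k `^ sigma)).
    by rewrite ler_wpM2r ?powR_ge0// ler_wpM2l// ltW.
  apply: le_trans le _; rewrite le_eqVlt; apply/orP; left; apply/eqP.
  rewrite /Y qr (_ : omega * t * _ =
    t * (q * omega) * (1 + e) + t * omega * (1 + e) * rho); last ring.
  rewrite expRD; have eN := expRxMexpNx_1 (t * (q * omega) * (1 + e)).
  set X1 := expR (t * (q * omega) * (1 + e)) in eN *.
  set X2 := expR (- _) in eN *.
  rewrite (_ : t * X2 * _ = X1 * X2 * (t * t^-1) *
    (C / q * (expR (t * omega * (1 + e) * rho) * a00 `^ rho) * a00 `^ q)); last ring.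
  by rewrite eN mulfV ?gt_eqF// !mul1r.
have xle : x k <= (C / q) `^ sigma^-1 * t `^ (- sigma^-1) *
      expR (omega * t * (gamma * (1 + e))) * a00 `^ gamma.
  have xk : x k = (x k `^ sigma) `^ sigma^-1.
    by rewrite -powRrM mulfV ?gt_eqF// powRr1.
  rewrite [leLHS]xk; apply: (@le_trans _ _ (Y `^ sigma^-1)).
    apply: ge0_ler_powR; rewrite ?nnegrE ?powR_ge0 ?invr_ge0 ?(ltW sigma_gt0)//.
    exact: le_trans (powR_ge0 _ _) xY.
  rewrite /Y !powRM ?powR_ge0 ?expR_ge0 ?invr_ge0 ?mulr_ge0 ?divr_ge0 ?invr_ge0
    ?(ltW t0) ?(ltW C_gt0) ?(ltW q0)//.
  rewrite -powRrM -/gamma -expRM -(powR_inv1 (ltW t0)) -powRrM mulN1r.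
  rewrite (_ : omega * t * ((q + rho) * (1 + e)) / sigma =
    omega * t * (gamma * (1 + e)))//.
  by rewrite /gamma; field; rewrite gt_eqF.
set s := (m - (k %/ N).+1)%:R * (t / m%:R).
have s0 : 0 <= s by rewrite mulr_ge0// divr_ge0// ltW.
have st : s <= t.
  by rewrite /s mulrCA ler_piMr ?(ltW t0)// ler_pdivrMr// mul1r ler_nat leq_subr.
exists (T s (c k.+1)), (T s (c' k.+1)); split; [exact: Hc|exact: Hc'|].
have dc : dom A (c k.+1) by have [w Aw _] := cc k kn; exists (c k.+1, w).
have dc' : dom A (c' k.+1) by have [w Aw _] := cc' k kn; exists (c' k.+1, w).
have gr_s : (Ldist mu r (T s (c k.+1)) (T s (c' k.+1)) <=
    (expR (omega * s) * x k)%:E)%E.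
  rewrite EFinM -xE; move: s0; rewrite le_eqVlt => /predU1P[<-|s0].
    have [-> _] := T_gen (dom_closure dc); have [-> _] := T_gen (dom_closure dc').
    by rewrite mulr0 expR0 mul1e.
  by apply: T_growth => //; [exact: dom_closure|exact: dom_closure|
    exact: dom_finite_norm|exact: dom_finite_norm].
apply: le_trans gr_s _; rewrite lee_fin.
rewrite (_ : dst u u' = a00); last by rewrite /a00 /a c0 c'0.
(* The position of k, hence s, is not known, so e^(omega s) is bounded by e^(omega t). This is the
   summand 1 in beta = gamma + 1. *)
apply: (@le_trans _ _ (expR (omega * t) * x k)).
  by rewrite ler_wpM2r// ler_expR ler_wpM2l.
apply: le_trans (ler_wpM2l (expR_ge0 _) xle) _.
rewrite (mulrDr (omega * t)) mulr1 expRD le_eqVlt; apply/orP; left; apply/eqP; ring.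
Qed.

(** The points u and u' are replaced by nearby points of D(A), at a cost controlled by the Lipschitz
    continuity of T t in L^q. *)
Lemma closure_approx u u' t e : Lq_closure (dom A) u -> Lq_closure (dom A) u' ->
  0 < t -> 0 < e ->
  exists z z' : Lq, [/\ dst z (T t u) <= e, dst z' (T t u') <= e &
    (Ldist mu r z z' <= ((C / q) `^ sigma^-1 * t `^ (- sigma^-1) *
      expR (omega * t * (1 + gamma * (1 + e))) * (dst u u' + e) `^ gamma)%:E)%E].
Proof.
move=> clu clu' t0 e0; pose E := expR (2 * t * omega).
have E0 : 0 < E by exact: expR_gt0.
have E1 : 1 <= E by rewrite -expR0 ler_expR !mulr_ge0// ltW.
(* Both e1 and E e1 are at most e/2: the former for the change in the distance of the initial
   points, the latter for the change in T t. *)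
pose e1 := e / 2 / E.
have e10 : 0 < e1 by rewrite !divr_gt0.
have Ee1 : E * e1 = e / 2 by rewrite /e1 mulrC divfK// gt_eqF.
have e1e : e1 <= e / 2 by rewrite -Ee1 -[leLHS]mul1r ler_wpM2r// ltW.
have near_dom w : Lq_closure (dom A) w -> exists2 y, dom A y & dst w y <= e1.
  by move=> /(_ _ e10)[y Ay]; rewrite dstE lte_fin => /ltW; exists y.
have [y Ay uy] := near_dom _ clu; have [y' Ay' uy'] := near_dom _ clu'.
have e20 : 0 < e / 2 by rewrite divr_gt0.
have [z [z' [zy zy' zz']]] := dom_approx Ay Ay' t0 e20.
have lip w v : Lq_closure (dom A) w -> dom A v -> dst w v <= e1 ->
    dst (T t v) (T t w) <= e / 2.
  move=> clw Av wv; rewrite -Ee1 dstC.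
  apply: le_trans (semigroup_lipschitz A_acc omega_ge0 T_gen clw (dom_closure Av) t0) _.
  by rewrite ler_wpM2l// ltW.
exists z, z'; split.
- by have := dst_triangle (T t y) z (T t u); have := lip _ _ clu Ay uy; lra.
- by have := dst_triangle (T t y') z' (T t u'); have := lip _ _ clu' Ay' uy'; lra.
have gamma0 : 0 <= gamma.
  by rewrite divr_ge0 ?(ltW sigma_gt0)// addr_ge0// (le_trans ler01)// -lee_fin.
apply: le_trans zz' _; rewrite lee_fin; apply: ler_pM.
- by rewrite !mulr_ge0// ?powR_ge0// expR_ge0.
- exact: powR_ge0.
- apply: ler_wpM2l; first by rewrite mulr_ge0// powR_ge0.
  rewrite ler_expR ler_wpM2l ?mulr_ge0 ?(ltW t0)// lerD2l ler_wpM2l// lerD2l; lra.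
apply: ge0_ler_powR; rewrite ?nnegrE ?addr_ge0 ?dst_ge0 ?(ltW e0)//.
have := dst_triangle u y y'; have := dst_triangle u' u y'; rewrite (dstC y u).
lra.
Qed.

Lemma smoothing u u' t : Lq_closure (dom A) u -> Lq_closure (dom A) u' -> 0 < t ->
  (Ldist mu r (T t u) (T t u') <= ((C / q) `^ sigma^-1 * t `^ (- sigma^-1) *
      expR (omega * (gamma + 1) * t) * dst u u' `^ gamma)%:E)%E.
Proof.
move=> clu clu' t0.
have gamma0 : 0 < gamma.
  by rewrite divr_gt0// ltr_pwDl// (lt_le_trans ltr01)// -lee_fin.
pose K := (C / q) `^ sigma^-1 * t `^ (- sigma^-1).
(* The absolute value keeps the base of the power nonnegative on both sides of 0, so F tends to the
   claimed bound by continuity. The conclusion then follows by lower semicontinuity of the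
   L^r-distance. *)
pose F e := K * expR (omega * t * (1 + gamma * (1 + e))) * (dst u u' + `|e|) `^ gamma.
have F0 : F e @[e --> 0] --> K * expR (omega * (gamma + 1) * t) * dst u u' `^ gamma.
  rewrite (_ : omega * (gamma + 1) * t = omega * t * (1 + gamma * (1 + 0))); last ring.
  apply: cvgM.
    apply: cvgM; first exact: cvg_cst.
    apply: continuous_cvg; first exact: continuous_expR.
    apply: cvgM; first exact: cvg_cst.
    apply: cvgD; first exact: cvg_cst.
    apply: cvgM; first exact: cvg_cst.
    by apply: cvgD; [exact: cvg_cst|exact: cvg_id].
  apply: cvg_powR => //; [exact: dst_ge0|by move=> e; rewrite addr_ge0// dst_ge0|].
  rewrite -[X in _ --> X]addr0 -[X in _ + X](@normr0 _ R).
  apply: cvgD; first exact: cvg_cst.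
  by apply: cvg_norm; exact: cvg_id.
apply: (Ldist_lower_semicontinuous r1).
  by rewrite !mulr_ge0// ?powR_ge0// expR_ge0.
move=> e e0.
move/cvgrPdist_le : F0 => /(_ _ e0)/nbhs_ballP[dl /= dl0 H].
pose e1 := Num.min e (dl / 2).
have e10 : 0 < e1 by rewrite lt_min e0 divr_gt0.
have e1e : e1 <= e by rewrite ge_min lexx.
have e1d : e1 < dl.
  by rewrite gt_min; apply/orP; right; rewrite ltr_pdivrMr//; lra.
have [z [z' [h1 h2 h3]]] := closure_approx clu clu' t0 e10.
exists z, z'; split; [exact: le_trans e1e|exact: le_trans e1e|].
apply: le_trans h3 _; rewrite lee_fin.
have := H e1; rewrite /ball/= sub0r normrN (gtr0_norm e10) => /(_ e1d).
rewrite /F (gtr0_norm e10) ler_distlC => /andP[_].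
by rewrite -/K.
Qed.

End Smoothing.

Theorem theorem3p3 (d : measure_display) (S : measurableType d) (R : realType)
  (mu : {sigma_finite_measure set S -> \bar R})
  (q : R) (q1 : (1 <= q%:E)%E) (omega : R) (omega_ge0 : 0 <= omega)
  (A : operator mu q1) (A_macc : m_accretive (lin_op omega 1 A))
  (r : \bar R) (r1 : (1 <= r)%E) (rho sigma C : R)
  (rho_ge0 : 0 <= rho) (sigma_gt0 : 0 < sigma) (C_gt0 : 0 < C)
  (* non-degeneracy: D(A) meets L^r; without it the growth condition on T
     can be void and the conclusion fails *)
  (domA_Lr : exists2 u : LspaceType mu q1, dom A u & finite_norm mu r u)
  (GN : forall u v u' v' : LspaceType mu q1, A (u, v) -> A (u', v') ->
    (Ldist mu r u u' `^ sigma <=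
     C%:E *
     (bracket mu q (u \- u')%R (v \- v')%R + omega%:E * Ldist mu q%:E u u' `^ q) *
     Ldist mu q%:E u u' `^ rho)%E)
  (T : R -> LspaceType mu q1 -> LspaceType mu q1)
  (T_gen : generated_semigroup A T)
  (T_growth : forall (u u' : LspaceType mu q1) (t : R),
    Lq_closure (dom A) u -> Lq_closure (dom A) u' ->
    finite_norm mu r u -> finite_norm mu r u' -> 0 < t ->
    (Ldist mu r (T t u) (T t u') <=
     (expR (omega * t))%:E * Ldist mu r u u')%E) :
  let alpha := sigma^-1 in
  let gamma := (q + rho) / sigma in
  let beta := gamma + 1 in
  forall (t : R) (u u' : LspaceType mu q1), 0 < t ->
    Lq_closure (dom A) u -> Lq_closure (dom A) u' ->
    (Ldist mu r (T t u) (T t u') <=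
     (((C / q) `^ (sigma^-1) * t `^ (- alpha) * expR (omega * beta * t))%R)%:E *
     Ldist mu q%:E u u' `^ gamma)%E.
Proof.
move=> alpha gamma beta t u u' t0 clu clu'.
rewrite dstE poweR_EFin -EFinM.
have := smoothing omega_ge0 A_macc.1 r1 rho_ge0 sigma_gt0 C_gt0 domA_Lr GN T_gen
  T_growth clu clu' t0.
exact.
Qed.
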